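(* Let $M$ be a locally connected topological space. Consider the set $\mathcal E$ of couples $(U,\mathcal A)$ where $U\subset M$ is portly and $\mathcal A$ is a $(G,X)$-structure on $U$ (that is, $\mathcal A$ is an almost everywhere $(G,X)$-structure on $M$ defined on $U$). Order $\mathcal E$ by: $(U,\mathcal A)\le(U',\mathcal A')$ if $U\subset U'$ and the restriction of $\mathcal A'$ to $U$ is compatible with $\mathcal A$. Then for every $(U,\mathcal A)\in\mathcal E$, the set of elements of $\mathcal E$ greater than $(U,\mathcal A)$ has a maximum.
   Context: $(G,X)$ is an analytical structure: $X$ is a connected, locally connected, Hausdorff topological space and $G$ is a group acting faithfully on $X$ by homeomorphisms such that for all $\phi_1,\phi_2\in G$ and every nonempty open $U\subset X$, if $\phi_1$ and $\phi_2$ agree on $U$ they agree on $X$. A $(G,X)$-atlas on a space $U$ is an atlas of charts (homeomorphisms from open subsets of $U$ to open subsets of $X$) covering $U$ whose changes of charts are locally restrictions of the action of elements of $G$; two atlases on $U$ are compatible if their union is a $(G,X)$-atlas, and a $(G,X)$-structure is a $(G,X)$-atlas up to compatibility (equivalently a maximal atlas). A subset $U$ of $M$ is portly if it is open, dense and locally connected in $M$, the last meaning that $W\cap U$ is connected for every open connected $W\subset M$. An almost everywhere (a.e.) $(G,X)$-atlas on $M$ is a $(G,X)$-atlas defined on some portly subset of $M$. *)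

(* Defs.v *)
From HB Require Import structures.
From mathcomp Require Import all_boot all_order.
From mathcomp Require Import boolp classical_sets functions topology.

Set Implicit Arguments.
Unset Strict Implicit.
Unset Printing Implicit Defensive.

Local Open Scope classical_set_scope.

Definition homeomorphism_on (S T : topologicalType) (A : set S) (B : set T)
    (f : S -> T) : Prop :=
  [/\ set_bij A B f,
      {within A, continuous f}
    & exists2 g : T -> S,
        (forall x, A x -> g (f x) = x) & {within B, continuous g}].

Definition locally_connected_space (T : topologicalType) : Prop :=
  forall (x : T) (N : set T), nbhs x N ->
    exists W : set T, [/\ open W, connected W, W x & W `<=` N].

Record analytical_structure (G : groupType) (X : topologicalType)
    (act : G -> X -> X) : Prop := AnalyticalStructure {
  space_connected : connected [set: X];
  space_locally_connected : locally_connected_space X;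
  space_hausdorff : hausdorff_space X;
  act1 : forall x, act 1%g x = x;
  actM : forall g h x, act (g * h)%g x = act g (act h x);
  act_faithful : forall g, (forall x, act g x = x) -> g = 1%g;
  act_homeomorphism : forall g, homeomorphism_on setT setT (act g);
  act_analytic : forall (g h : G) (U : set X), open U -> U !=set0 ->
    (forall x, U x -> act g x = act h x) -> forall x, act g x = act h x
}.

Definition locally_connected_in (M : topologicalType) (U : set M) : Prop :=
  forall W : set M, open W -> connected W -> connected (W `&` U).

Definition portly (M : topologicalType) (U : set M) : Prop :=
  [/\ open U, dense U & locally_connected_in U].

(* Only the values of chart_map on chart_dom are meaningful. A chart and its
   modifications outside chart_dom are mutually compatible, so a maximal atlas
   contains either all of them or none, and equality of maximal atlases is the
   intended one. *)
Record chart (M X : Type) := Chart {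
  chart_dom : set M;
  chart_map :> M -> X
}.

Section Atlases.
Variables (G : groupType) (M X : topologicalType) (act : G -> X -> X).
Implicit Types (U : set M) (A B : set (chart M X)).

(* U is always open in what follows, so that the open subsets of U are the open
   subsets of M contained in U. *)
Definition is_chart U (c : chart M X) : Prop :=
  [/\ open (chart_dom c), chart_dom c `<=` U, open (c @` chart_dom c)
    & homeomorphism_on (chart_dom c) (c @` chart_dom c) c].

(* Near each point c p of its domain, the change of charts c q |-> d q is the
   restriction of the action of some g. *)
Definition change_locally_in_G (c d : chart M X) : Prop :=
  forall p, chart_dom c p -> chart_dom d p ->
    exists g : G, exists O : set X, [/\ open O, O (c p)
      & forall q, chart_dom c q -> chart_dom d q -> O (c q) ->
          d q = act g (c q)].

Definition is_atlas U A : Prop :=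
  [/\ forall c, A c -> is_chart U c,
      forall p, U p -> exists2 c, A c & chart_dom c p
    & forall c d, A c -> A d -> change_locally_in_G c d].

Definition compatible U A B : Prop := is_atlas U (A `|` B).

Definition is_structure U A : Prop :=
  is_atlas U A /\ forall B, is_atlas U B -> A `<=` B -> B = A.

Definition restrict_chart U (c : chart M X) : chart M X :=
  Chart (chart_dom c `&` U) c.

Definition restrict_atlas U A : set (chart M X) := restrict_chart U @` A.

Definition ae_structures : set (set M * set (chart M X)) :=
  [set e | portly e.1 /\ is_structure e.1 e.2].

Definition ae_le (e e' : set M * set (chart M X)) : Prop :=
  e.1 `<=` e'.1 /\ compatible e.1 (restrict_atlas e.1 e'.2) e.2.

End Atlases.

Definition is_maximum (T : Type) (R : T -> T -> Prop) (S : set T) (m : T) :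
  Prop := S m /\ forall x, S x -> R x m.

(* Main.v *)
Require Import Defs.
From mathcomp Require Import all_boot all_order.
From mathcomp Require Import boolp classical_sets functions topology.

(** Every structure above [(U, A)] consists of charts whose changes with the
    charts of [A] are locally in [G]; call such a chart a chart over [A].  The
    theorem rests on the fact that any two charts [c], [d] over [A] have a
    change locally in [G], also at the points outside [U]
    ([over_atlas_change]).  Let [p] be in both domains and let [W] be a
    connected open neighbourhood of [p] contained in both.  Near each point of
    [W `&` U], composing through a chart of [A] gives [d = g . c] for some
    [g]; by analyticity and faithfulness this [g] is unique, hence locally
    constant, and since [W `&` U] is connected one [g] serves for all of it.
    As [W `&` U] is dense in [W] and [X] is Hausdorff, [d = g . c] holds on
    all of [W].

    Consequently, on any open set containing [U] that is covered by domains of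
    charts over [A], the set of all charts over [A] is an atlas, obviously the
    largest one containing [A].  Take for this open set the union [V] of the
    domains of all structures above [(U, A)]; it is portly because it is open
    and contains the portly set [U] ([portlyS]).  The charts over [A] on [V]
    then form a structure that contains every structure above [(U, A)], and a
    structure that contains another one is above it ([subatlas_compatible]). *)

Set Implicit Arguments.
Unset Strict Implicit.
Unset Printing Implicit Defensive.

Local Open Scope classical_set_scope.

(** * Connectedness and density *)

(** The points related to [i] form an open set; so do those related to some
    [j <> i], and on [D] the two are complementary.  The locally constant
    function is given by its graph [P], so that it needs no value outside
    [D]. *)
Lemma connected_locally_constant (T : topologicalType) (I : Type) (D : set T)
    (P : I -> T -> Prop) :
  connected D ->
  (forall i q, P i q -> \forall r \near q, P i r) ->
  (forall q, D q -> exists i, P i q) ->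
  (forall i j q, D q -> P i q -> P j q -> i = j) ->
  forall i q r, D q -> D r -> P i q -> P i r.
Proof.
move=> cD oP exP uniqP i q r Dq Dr Piq.
have oP' j : open [set x | P j x] by rewrite openE => x; exact: oP.
suff DP : D `&` [set x | P i x] = D by move: Dr; rewrite -DP => -[].
apply: cD; first by exists q.
  by exists [set x | P i x].
exists (~` \bigcup_(j in [set j | j <> i]) [set x | P j x]).
  by apply: open_closedC; apply: bigcup_open.
apply/seteqP; split=> x [Dx].
  by move=> Pix; split=> // -[j ji Pjx]; apply: ji; exact: (uniqP j i x).
move=> nPx; split=> //=; have [j Pjx] := exP x Dx.
have [<- //|ji] := pselect (j = i).
by case: nPx; exists j.
Qed.

Lemma connected_between (T : topologicalType) (A B : set T) :
  connected A -> A `<=` B -> B `<=` closure A -> connected B.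
Proof.
move=> cA AB BA E [x Ex] [C oC EC] [F cF EF].
have AEF : A `&` E = A.
  apply: cA.
  - have : (B `&` C) x by rewrite -EC.
    move=> [Bx Cx]; have [|y [Ay Cy]] := BA x Bx C.
      by apply: open_nbhs_nbhs.
    by exists y; split=> //; rewrite EC; split=> //; exact: AB.
  - exists C => //; rewrite EC setIA; congr (_ `&` _); exact/setIidPl.
  - exists F => //; rewrite EF setIA; congr (_ `&` _); exact/setIidPl.
rewrite EF; apply/setIidPl => y /BA clAy; apply: cF; apply: closureS clAy => z.
by rewrite -AEF EF => -[_ []].
Qed.

(** For a connected open [W], the set [W `&` V] lies between the connected set
    [W `&` U] and its closure, which contains [W] by density. *)
Lemma portlyS (M : topologicalType) (U V : set M) :
  portly U -> U `<=` V -> open V -> portly V.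
Proof.
move=> [oU dU lU] UV oV; split=> //.
  move=> O O0 oO; have [x [Ox Ux]] := dU O O0 oO.
  by exists x; split=> //; exact: UV.
move=> W oW cW; apply: connected_between (lU W oW cW) _ _.
  exact: setIS.
move=> x [Wx _] B; rewrite nbhsE => -[C [oC Cx] CB].
have [|y [[Wy Cy] Uy]] := dU (W `&` C) _ (openI oW oC); first by exists x.
by exists y; split=> //; exact: CB.
Qed.

Lemma hausdorff_dense_eq (T Y : topologicalType) (f g : T -> Y) (W D : set T) :
  hausdorff_space Y -> open W -> dense D ->
  {in W, continuous f} -> {in W, continuous g} ->
  (forall q, W q -> D q -> f q = g q) -> forall q, W q -> f q = g q.
Proof.
move=> hY oW dD cf cg fg q Wq; apply: hY => A B Af Bg.
have qW : q \in W by rewrite inE.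
have fA : \forall r \near q, A (f r) := cf q qW A Af.
have gB : \forall r \near q, B (g r) := cg q qW B Bg.
have : nbhs q (f @^-1` A `&` g @^-1` B `&` W).
  by apply: filterI (filterI fA gB) _; exact: open_nbhs_nbhs.
rewrite nbhsE => -[O [oO Oq] OW].
have [|r [Or Dr]] := dD O _ oO; first by exists q.
have [[Afr Bgr] Wr] := OW r Or.
by exists (f r); split=> //; rewrite fg.
Qed.

(** * Charts *)

Section Charts.
Variables (G : groupType) (M X : topologicalType) (act : G -> X -> X).
Hypothesis hGX : analytical_structure act.
Implicit Types (U V W : set M) (A B : set (chart M X)) (a c d : chart M X).

Lemma chart_continuous U c : is_chart U c -> {in chart_dom c, continuous c}.
Proof. by case=> oc _ _ [_]; rewrite continuous_open_subspace. Qed.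

Lemma chart_nbhs U c p :
  is_chart U c -> chart_dom c p -> nbhs p (chart_dom c).
Proof. by case=> oc _ _ _ cp; exact: open_nbhs_nbhs. Qed.

Lemma chart_inj U c p q :
  is_chart U c -> chart_dom c p -> chart_dom c q -> c p = c q -> p = q.
Proof. by case=> _ _ _ [[_ cI _] _ _] cp cq; apply: cI; rewrite inE. Qed.

Lemma chart_open_image U c W :
  is_chart U c -> open W -> W `<=` chart_dom c -> open (c @` W).
Proof.
move=> [_ _ oI [_ _ [g gK]]]; rewrite continuous_open_subspace// => cg oW Wc.
suff -> : c @` W = c @` chart_dom c `&` g @^-1` W.
  by move/continuous_inP: cg => /(_ oI); exact.
apply/seteqP; split=> [_ [x Wx <-]|_ [[x cx <-]]] /=.
  by split; [exists x => //; exact: Wc | rewrite gK//; exact: Wc].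
by rewrite gK// => Wx; exists x.
Qed.

Lemma chartS U V c : U `<=` V -> is_chart U c -> is_chart V c.
Proof. by move=> UV [oc cU oI hc]; split=> //; exact: subset_trans UV. Qed.

Lemma restrict_is_chart U V c :
  open U -> is_chart V c -> is_chart U (restrict_chart U c).
Proof.
move=> oU hc; have oI := chart_open_image hc.
case: (hc) => oc cV _ [[_ cI _] ct [g gK cg]].
have sub : chart_dom c `&` U `<=` chart_dom c by apply: subIsetl.
split=> /=; first exact: openI.
- exact: subIsetr.
- by apply: oI => //; exact: openI.
- split; first split.
  + by move=> x ? /=; exists x.
  + by move=> x y; rewrite !inE => -[cx _] [cy _]; apply: cI; rewrite inE.
  + by move=> x /=.
  + exact: continuous_subspaceW ct.
  exists g; first by move=> x [cx _]; exact: gK.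
  by apply: continuous_subspaceW cg; exact: image_subset.
Qed.

(** * Changes of charts *)

Lemma act_inj_eq (g h : G) : (forall x, act g x = act h x) -> g = h.
Proof.
move=> gh; have : (h^-1 * g)%g = 1%g.
  apply: (act_faithful hGX) => x.
  by rewrite (actM hGX) gh -(actM hGX) mulVg (act1 hGX).
by move/(congr1 (fun k => h * k)%g); rewrite mulVKg mulg1.
Qed.

Lemma act_continuous g : continuous (act g).
Proof.
by apply/continuous_subspace_setT; case: (act_homeomorphism hGX g).
Qed.

(** Since charts are open maps, a change of charts may be localized in [M]
    rather than in [X]; this makes changes easy to compose and to restrict. *)
Lemma change_nearP U V c d : is_chart U c -> is_chart V d ->
  change_locally_in_G act c d <->
  forall p, chart_dom c p -> chart_dom d p ->
    exists g, \forall q \near p, d q = act g (c q).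
Proof.
move=> hc hd; split=> cd p cp dp; have := cd p cp dp.
  move=> [g [O [oO Ocp gcd]]]; exists g.
  have /(chart_continuous hc) cc : p \in chart_dom c by rewrite inE.
  apply: filterS (filterI (filterI (chart_nbhs hc cp)
    (chart_nbhs hd dp)) (cc O (open_nbhs_nbhs (conj oO Ocp)))).
  by move=> q [[cq dq] Oq]; exact: gcd.
move=> [g]; rewrite -nbhs_nearE nbhsE => -[N [oN Np] Nq].
have oc : open (chart_dom c) by case: hc.
exists g, (c @` (N `&` chart_dom c)); split.
- by apply: (chart_open_image hc); [exact: openI | exact: subIsetr].
- by exists p.
- move=> q cq _ [r [Nr cr]] /(chart_inj hc cr cq) <-; exact: Nq.
Qed.

(** This is where analyticity enters: the image of a neighbourhood by a chart is
    a nonempty open subset of [X], on which [g] and [h] agree. *)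
Lemma change_near_unique U c d g h p : is_chart U c -> chart_dom c p ->
  (\forall q \near p, d q = act g (c q)) ->
  (\forall q \near p, d q = act h (c q)) -> g = h.
Proof.
move=> hc cp dg dh; apply: act_inj_eq.
have : nbhs p ([set q | d q = act g (c q) /\ d q = act h (c q)]
    `&` chart_dom c).
  by apply: filterI (filterI dg dh) _; exact: chart_nbhs hc cp.
rewrite nbhsE => -[N [oN Np] Nq].
apply: (act_analytic hGX (U := c @` N)).
- by apply: (chart_open_image hc) => // q /Nq [].
- by exists (c p); exists p.
- by move=> _ [q /Nq [[/= dgq dhq] _] <-]; rewrite -dgq -dhq.
Qed.

Lemma change_near_comp c a d g h (p : M) :
  (\forall q \near p, a q = act g (c q)) ->
  (\forall q \near p, d q = act h (a q)) ->
  \forall q \near p, d q = act (h * g)%g (c q).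
Proof.
by apply: filterS2 => q ag ->; rewrite ag (actM hGX).
Qed.

Lemma change_restrictl U c d :
  change_locally_in_G act c d ->
  change_locally_in_G act (restrict_chart U c) d.
Proof.
move=> cd p [cp _] dp; have [g [O [oO Op gO]]] := cd p cp dp.
by exists g, O; split=> // q [cq _]; exact: gO.
Qed.

Lemma change_restrictr U c d :
  change_locally_in_G act c d ->
  change_locally_in_G act c (restrict_chart U d).
Proof.
move=> cd p cp [dp _]; have [g [O [oO Op gO]]] := cd p cp dp.
by exists g, O; split=> // q cq [dq _]; exact: gO.
Qed.

Lemma change_unrestrictl U c d : chart_dom d `<=` U ->
  change_locally_in_G act (restrict_chart U c) d ->
  change_locally_in_G act c d.
Proof.
move=> dU cd p cp dp; have [|g [O [oO Op gO]]] := cd p _ dp.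
  by split=> //; exact: dU.
by exists g, O; split=> // q cq dq; apply: gO => //; split=> //; exact: dU.
Qed.

Lemma change_unrestrictr U c d : chart_dom c `<=` U ->
  change_locally_in_G act c (restrict_chart U d) ->
  change_locally_in_G act c d.
Proof.
move=> cU cd p cp dp; have [|g [O [oO Op gO]]] := cd p cp.
  by split=> //; exact: cU.
by exists g, O; split=> // q cq dq; apply: gO => //; split=> //; exact: cU.
Qed.

(** * Charts over an atlas *)

(** The domain of [c] may leave the union of the domains of the charts of [A];
    there nothing is asked of [c]. *)
Definition over_atlas A c : Prop :=
  forall a, A a -> change_locally_in_G act c a /\ change_locally_in_G act a c.

Lemma compatible_over_atlas U A B c :
  compatible act U (restrict_atlas U B) A -> B c -> over_atlas A c.
Proof.
move=> [hch _ hco] Bc a Aa.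
have Aa' : (restrict_atlas U B `|` A) a by right.
have Bc' : (restrict_atlas U B `|` A) (restrict_chart U c).
  by left; exists c.
have [_ aU _ _] := hch a Aa'.
split; first exact: (change_unrestrictl aU (hco _ _ Bc' Aa')).
exact: (change_unrestrictr aU (hco _ _ Aa' Bc')).
Qed.

(** The restricted charts change among themselves and with the charts of [A] as
    the charts of [B] do.  This turns an inclusion of atlases into an inequality
    for the order on almost everywhere structures. *)
Lemma subatlas_compatible U V A B : open U ->
  is_atlas act U A -> is_atlas act V B -> A `<=` B ->
  compatible act U (restrict_atlas U B) A.
Proof.
move=> oU [Ach Acov _] [Bch _ Bco] AB; split.
- move=> _ [[c Bc <-]|/Ach//].
  exact: (restrict_is_chart oU (Bch c Bc)).
- by move=> p /Acov [a Aa ap]; exists a => //; right.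
- have BB : forall c d, B c -> B d -> change_locally_in_G act c d by [].
  move=> c' d' [[c Bc <-]|/AB Bc] [[d Bd <-]|/AB Bd].
  + by apply: change_restrictl; apply: change_restrictr; exact: BB.
  + by apply: change_restrictl; exact: BB.
  + by apply: change_restrictr; exact: BB.
  + exact: BB.
Qed.

(** The element [g] found on [W `&` U] is forced on all of the connected
    neighbourhood [W], by density and separation. *)
Lemma over_atlas_change U V A c d : locally_connected_space M ->
  portly U -> is_atlas act U A -> is_chart V c -> is_chart V d ->
  over_atlas A c -> over_atlas A d -> change_locally_in_G act c d.
Proof.
move=> hM [oU dU lU] [Ach Acov _] hc hd Ac Ad.
apply/(change_nearP hc hd) => p cp dp.
have [W [oW cW Wp WN]] :=
  hM p _ (filterI (chart_nbhs hc cp) (chart_nbhs hd dp)).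
have Wc q : W q -> chart_dom c q by move/WN => [].
have Wd q : W q -> chart_dom d q by move/WN => [].
have exg q : (W `&` U) q -> exists g, \forall r \near q, d r = act g (c r).
  move=> [Wq Uq]; have [a Aa aq] := Acov q Uq.
  have [/(change_nearP hc (Ach a Aa)) ca _] := Ac a Aa.
  have [_ /(change_nearP (Ach a Aa) hd) ad] := Ad a Aa.
  have [g ga] := ca q (Wc q Wq) aq; have [h hh] := ad q aq (Wd q Wq).
  by exists (h * g)%g; exact: change_near_comp ga hh.
have [|q [Wq Uq]] := dU W _ oW; first by exists p.
have [g gq] := exg q (conj Wq Uq).
exists g; apply: filterS (open_nbhs_nbhs (conj oW Wp)).
apply: (@hausdorff_dense_eq _ _ d (act g \o c) W U) => //.
- exact: space_hausdorff hGX.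
- by move=> r /set_mem/Wd/mem_set; exact: chart_continuous hd r.
- move=> r /set_mem/Wc/mem_set /(chart_continuous hc) cr.
  by apply: continuous_comp => //; exact: act_continuous.
move=> r Wr Ur; apply: (@nbhs_singleton _ r [set x | d x = act g (c x)]).
apply: (@connected_locally_constant M G (W `&` U)
  (fun g q => \forall r \near q, d r = act g (c r)) _ _ exg _ g q r) => //.
- exact: lU.
- by move=> i s /nbhs_interior.
- by move=> i j s [/Wc cs _]; exact: (change_near_unique hc cs).
Qed.

End Charts.

Theorem corollary3p4 (G : groupType) (X : topologicalType) (act : G -> X -> X)
    (hGX : analytical_structure act)
    (M : topologicalType) (hM : locally_connected_space M)
    (e : set M * set (chart M X)) (he : ae_structures act e) :
  exists m : set M * set (chart M X),
    is_maximum (ae_le act)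
      [set e' | ae_structures act e' /\ ae_le act e e'] m.
Proof.
case: e he => U A [/= pU [hA maxA]].
have oU : open U by case: pU.
set S := [set e' | _].
pose V := \bigcup_(e' in S) e'.1.
pose B := [set c : chart M X | is_chart V c /\ over_atlas act A c].
have SU : S (U, A).
  do 2 split=> //=.
  exact: (subatlas_compatible oU hA hA).
have UV : U `<=` V by move=> p Up; exists (U, A).
have pV : portly V.
  apply: (portlyS pU UV); apply: bigcup_open.
  by move=> e' [[[]]].
have SB e' : S e' -> e'.2 `<=` B.
  move=> Se' c e'c; have [[_ [[e'ch _ _] _]] [_ comp]] := Se'; split.
    apply: chartS (e'ch c e'c).
    by move=> p e'p; exists e'.
  exact: compatible_over_atlas comp e'c.
have hB : is_atlas act V B.
  split=> [c [] //|p [e' Se' e'p]|c d [hc Ac] [hd Ad]].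
    have [[_ [[_ e'cov _] _]] _] := Se'; have [c e'c cp] := e'cov p e'p.
    by exists c => //; exact: SB Se' _ e'c.
  exact: (over_atlas_change hGX hM pU hA hc hd Ac Ad).
have leB e' : S e' -> ae_le act e' (V, B).
  move=> Se'; split; first by move=> p e'p; exists e'.
  have [[[oe' _ _] [he' _]] _] := Se'.
  exact: (subatlas_compatible oe' he' hB (SB e' Se')).
exists (V, B); split; last exact: leB.
split; last exact: leB.
split=> //=; split=> // C [Cch _ Cco] BC; apply/seteqP; split=> // c Cc.
by split=> [|a /(SB _ SU)/BC Ca]; [exact: Cch | split; exact: Cco].
Qed.
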